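(* Let $c>0$ and $\alpha<1/2$ be real numbers and let $(N_n)_{n\geq 1}$ be a sequence of positive integers with $N_n\sim c\,n^{\alpha}$ as $n\to\infty$. For each $n$ let $\lambda_n$ be a random Young diagram of size $n$ distributed according to the Schur-Weyl measure of parameters $n$ and $N_n$, and let $\lambda_1$ denote the length of its first (longest) row. Then for every $\varepsilon>0$, $\lambda_1=o(n^{1-\alpha+\varepsilon})$ in probability, i.e. $\lambda_1/n^{1-\alpha+\varepsilon}\to0$ in probability as $n\to\infty$.
   Context: The symmetric group $\mathfrak{S}_n$ acts on $(\mathbb{C}^N)^{\otimes n}$ by permuting the tensor factors. For a partition $\lambda$ of $n$ let $S_\lambda$ be the irreducible representation of $\mathfrak{S}_n$ indexed by $\lambda$ (Specht module) and $m_\lambda$ its multiplicity in $(\mathbb{C}^N)^{\otimes n}$. The Schur-Weyl measure of parameters $n$ and $N$ is the probability measure on partitions of size $n$ given by $$\mathbb{P}[\lambda]=\frac{m_\lambda\cdot\dim(S_\lambda)}{N^n}.$$ It is the image of the uniform distribution on words of length $n$ with letters in $\{1,\dots,N\}$ under the map sending a word to the shape of its RSK tableaux. *)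

(* Defs.v *)
From HB Require Import structures.
From mathcomp Require Import all_boot all_order all_algebra all_fingroup.
From mathcomp Require Import mxrepresentation.
From mathcomp Require Import all_classical all_reals all_analysis.
From mathcomp Require Import complex.

Set Implicit Arguments.
Unset Strict Implicit.
Unset Printing Implicit Defensive.

Import Order.TTheory GRing.Theory Num.Theory.
Import numFieldNormedType.Exports.

Local Open Scope ring_scope.

(* Partitions of n: weakly decreasing sequences of positive parts. *)
Definition is_partition (n : nat) (s : seq nat) : bool :=
  [&& sorted geq s, 0%N \notin s & sumn s == n].

Record partition_of (n : nat) := PartitionOf {
  parts :> seq nat;
  partsP : is_partition n parts }.

HB.instance Definition _ (n : nat) := [isSub for @parts n].
HB.instance Definition _ (n : nat) := [Countable of partition_of n by <:].

Definition first_row (n : nat) (la : partition_of n) : nat := head 0%N la.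

Section TensorPower.
Variables (F : fieldType) (n : nat) (X : finType).

(* A word w : {ffun 'I_n -> X} stands for the basis vector
   e_(w 0) (x) ... (x) e_(w (n-1)) of the n-th tensor power of F^X; vectors of
   the tensor power are row vectors indexed by the enumeration of words. *)
Local Notation word := {ffun 'I_n -> X}.

Definition word_vec (w : word) : 'rV[F]_#|{: word}| := delta_mx 0 (enum_rank w).

(* The factor in position i is moved to position s i. *)
Definition word_perm (w : word) (s : 'S_n) : word :=
  [ffun i => w ((s^-1)%g i)].

(* Matrices act on row vectors on the right: word_vec w is sent by s to
   word_vec (word_perm w s). *)
Definition tensor_mx (s : 'S_n) : 'M[F]_#|{: word}| :=
  \matrix_i word_vec (word_perm (enum_val i) s).

Lemma word_vec_tensor_mx (w : word) (s : 'S_n) :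
  word_vec w *m tensor_mx s = word_vec (word_perm w s).
Proof. by rewrite -rowE rowK enum_rankK. Qed.

Lemma tensor_mx_repr : mx_repr [set: 'S_n] tensor_mx.
Proof.
split=> [|s t _ _]; apply/row_matrixP => i; rewrite rowK.
  rewrite row1 /word_vec; congr (delta_mx 0 _).
  rewrite -[RHS]enum_valK; congr (enum_rank _).
  by apply/ffunP => k; rewrite ffunE invg1 perm1.
rewrite row_mul rowK word_vec_tensor_mx; congr word_vec.
by apply/ffunP => k; rewrite !ffunE invMg permM.
Qed.

Definition tensor_repr : mx_representation F [set: 'S_n] #|{: word}| :=
  MxRepresentation tensor_mx_repr.

End TensorPower.

Section Specht.
Variables (F : fieldType) (n : nat) (la : partition_of n).

Lemma sumn_parts : sumn la = n.
Proof. by case/and3P: (partsP la) => _ _ /eqP. Qed.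

(* Row and column of the entry k in the tableau of shape la whose entries
   0, ..., n-1 are filled in row by row. *)
Lemma tab_row_subproof (k : 'I_n) : (reshape_index la k < size la)%N.
Proof. by apply: reshape_indexP; rewrite sumn_parts. Qed.

Definition tab_row (k : 'I_n) : 'I_(size la) := Ordinal (tab_row_subproof k).
Definition tab_col (k : 'I_n) : nat := reshape_offset la k.

(* A tabloid of shape la is determined by the row of each entry, i.e. it is a
   word with la_i letters equal to i; this is the tabloid {t} of the above
   tableau t.  The permutation module M^la on tabloids is thus a submodule of
   the n-th tensor power of F^(size la). *)
Definition tabloid : {ffun 'I_n -> 'I_(size la)} := [ffun k => tab_row k].

Definition col_stab : {set 'S_n} :=
  [set s : 'S_n | [forall k, tab_col (s k) == tab_col k]].

Definition polytabloid : 'rV[F]_#|{: {ffun 'I_n -> 'I_(size la)}}| :=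
  \sum_(s in col_stab) (-1) ^+ s *: word_vec F (word_perm tabloid s).

(* The Specht module is the span of all polytabloids of shape la; as these are
   permuted transitively by 'S_n, it is the module generated by one of them. *)
Definition specht_mx : 'M[F]_#|{: {ffun 'I_n -> 'I_(size la)}}| :=
  cyclic_mx (tensor_repr F n 'I_(size la)) polytabloid.

Definition specht_repr : mx_representation F [set: 'S_n] (\rank specht_mx) :=
  submod_repr
    (cyclic_mx_module (tensor_repr F n 'I_(size la)) polytabloid).

Definition dim_specht : nat := \rank specht_mx.

End Specht.

(* Multiplicity of an irreducible representation rS in rV: the multiplicity of
   its irreducible constituent in the isotypic component of rV whose
   constituents are similar to rS (0 if there is no such component). *)
Definition repr_mult (F : decFieldType) (gT : finGroupType) (G : {group gT})
    (d e : nat) (rV : mx_representation F G d) (rS : mx_representation F G e) :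
    nat :=
  (\sum_(W : DecSocleType rV | `[< mx_rsim (socle_repr W) rS >])
     socle_mult W)%N.

Definition schur_weyl_mult (F : decFieldType) (N n : nat)
    (la : partition_of n) : nat :=
  repr_mult (tensor_repr F n 'I_N) (specht_repr F la).

(* Probability mass function of the Schur-Weyl measure of parameters n and N,
   over the field R[i] of complex numbers. *)
Definition schur_weyl (R : realType) (N n : nat) (la : partition_of n) : R :=
  (schur_weyl_mult R[i] N la * dim_specht R[i] la)%:R / N%:R ^+ n.

(* Main.v *)
Require Import Defs.
From mathcomp Require Import all_boot all_order all_algebra all_fingroup.
From mathcomp Require Import mxrepresentation.
From mathcomp Require Import all_classical all_reals all_analysis.
From mathcomp Require Import complex zify ring lra.

(** The mechanism is the counting of weakly increasing subsequences in a random
    word, carried over from words to tensors.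

    A Specht module S_mu with mu_1 >= k contains a nonzero vector fixed by all
    permutations of k positions: symmetrize a polytabloid over the entries that
    start the first row ([specht_fixed]).  Hence every simple submodule of
    V = (C^N)^(x)n isomorphic to S_mu meets the sum U of the fixed spaces of the
    groups Sym A, where A ranges over the sets of k positions; U is stable under
    permutations, so it contains all these submodules.  Each fixed space has at
    most (k+1)^N N^(n-k) dimensions, since the orbit of a word under Sym A is
    determined by the number of occurrences of each letter in A and by the
    letters outside A; so dim U <= C(n,k) (k+1)^N N^(n-k)
    ([some_Sym_fixed_rank]).

    To pass from dim U to the sum of m_mu dim S_mu over a set of partitions,
    the modules S_mu have to be pairwise non isomorphic ([specht_inj]), so that
    they occupy distinct isotypic components, which are in direct sum.  An
    isomorphism from S_la to S_mu sends a polytabloid to a vector on which the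
    column group of la acts by the signature; a word occurring in that vector
    has distinct letters in each column of la, which forces la to dominate mu,
    and by symmetry la = mu.

    Therefore P(mu_1 >= k) <= C(n,k) (k+1)^N / N^k ([probability_long_row]).
    As C(n,k) <= (4n/k)^k, and (k+1)^N <= e^k as soon as N ln(2n) <= k <= n,
    this is at most (4en/(kN))^k.  With N ~ c n^alpha and
    k > delta n^(1-alpha+eps), the quotient N ln(2n) / k tends to 0 because
    2 alpha < 1, and the base 4en/(kN) is O(n^(-eps)). *)

Set Implicit Arguments.
Unset Strict Implicit.
Unset Printing Implicit Defensive.

Import Order.TTheory GRing.Theory Num.Theory.
Import numFieldNormedType.Exports.

Local Open Scope ring_scope.

(** * Fixed vectors and isotypic components *)

Section FixedVectors.

Variables (F : fieldType) (gT : finGroupType) (G : {group gT}).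
Local Notation reprG := (mx_representation F G).

Lemma rfix_rsim n1 n2 (rG1 : reprG n1) (rG2 : reprG n2) (H : {set gT}) :
    H \subset G -> mx_rsim rG1 rG2 ->
  rfix_mx rG1 H != 0 -> rfix_mx rG2 H != 0.
Proof.
move=> sHG [B _ freeB homB]; apply: contra => /eqP fix0.
have: (rfix_mx rG1 H *m B <= rfix_mx rG2 H)%MS.
  apply/rfix_mxP => x Hx.
  have Gx : x \in G by apply: (fintype.subsetP sHG).
  by rewrite -mulmxA -(homB x Gx) mulmxA rfix_mx_id.
by rewrite fix0 submx0 -!mxrank_eq0 mxrankMfree.
Qed.

(** The component is a sum of isomorphic copies of M.  Each copy has a nonzero
    vector fixed by H, the image of one of M, so it meets the module U and,
    being simple, lies in it. *)
Lemma component_sub_fixed n (rG : reprG n) (H : {set gT}) (M U : 'M[F]_n) :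
    H \subset G -> mxsimple rG M -> mxmodule rG U ->
    (rfix_mx rG H <= U)%MS -> (M :&: rfix_mx rG H)%MS != 0 ->
  (component_mx rG M <= U)%MS.
Proof.
move=> sHG simM modU fixU nzM.
have [I [W isoW ->]] := component_mx_def simM.
apply/sumsmx_subP => i _.
have simW := mx_iso_simple (isoW i) simM.
have [modW _ minW] := simW.
suff nzWU : (W i :&: U)%MS != 0.
  apply: submx_trans (capmxSr (W i) U).
  by apply: minW; rewrite ?capmx_module ?capmxSl.
have [f injf homf defW] := isoW i.
apply: contra nzM => /eqP WU0.
rewrite -mxrank_eq0 -(mxrankMfree _ (_ : row_free f)) ?row_free_unit //.
rewrite mxrank_eq0 -submx0 -WU0 sub_capmx.
rewrite -{1}defW submxMr ?capmxSl //=.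
apply: submx_trans fixU; apply/rfix_mxP => x Hx.
rewrite -(hom_mxP (submx_trans (capmxSl _ _) homf)); last first.
  exact: (fintype.subsetP sHG).
by rewrite (rfix_mxP H _) ?capmxSr.
Qed.

Lemma socle_sub_fixed n (rG : reprG n) (sG : socleType rG) (W : sG)
    (H : {set gT}) (U : 'M[F]_n) :
    H \subset G -> mxmodule rG U -> (rfix_mx rG H <= U)%MS ->
  rfix_mx (socle_repr W) H != 0 -> (W <= U)%MS.
Proof.
move=> sHG modU fixU nz.
rewrite /socle_val; apply: (component_sub_fixed sHG (socle_simple W) modU fixU).
apply: contra nz => /eqP fix0.
rewrite -submx0 (rfix_submod (socle_module W) sHG) fix0 linear0.
exact: sub0mx.
Qed.

End FixedVectors.

(** The sum is at most the dimension of a direct sum of isotypic components,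
    all of them contained in U.  A component counts for one index only since the
    rS i are pairwise non similar. *)
Lemma sum_repr_mult_le (F : decFieldType) (gT : finGroupType) (G : {group gT})
    (d : nat) (rV : mx_representation F G d) (I : eqType) (s : seq I)
    (e : I -> nat) (rS : forall i, mx_representation F G (e i))
    (U : 'M[F]_d) :
    uniq s -> mxmodule rV U ->
    {in s &, forall i j, mx_rsim (rS i) (rS j) -> i = j} ->
    {in s, forall i, exists H : {set gT},
      [/\ H \subset G, rfix_mx (rS i) H != 0 & (rfix_mx rV H <= U)%MS]} ->
  (\sum_(i <- s) repr_mult rV (rS i) * e i <= \rank U)%N.
Proof.
move=> uniq_s modU rS_inj fixS.
pose simS i (W : DecSocleType rV) := `[< mx_rsim (socle_repr W) (rS i) >].
have repr_mult_le i :
    (repr_mult rV (rS i) * e i <= \sum_(W | simS i W) \rank W)%N.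
  rewrite /repr_mult big_distrl /=; apply: leq_sum => W /asboolP simW.
  have -> : e i = \rank (socle_base W) by case: simW.
  exact: leq_divM.
apply: (leq_trans (leq_sum _ (fun i _ => repr_mult_le i))).
rewrite (exchange_big_dep xpredT) //=.
pose P W := has (simS^~ W) s.
have dirP : (\sum_(W : DecSocleType rV | P W) \rank W
             <= \rank (\sum_(W : DecSocleType rV | P W) W))%N.
  by rewrite (mxdirectP (subSocle_direct P)).
apply: (@leq_trans (\rank (\sum_(W : DecSocleType rV | P W) W))%N); last first.
  apply/mxrankS/sumsmx_subP => W /hasP[i si /asboolP simW].
  have [H [sHG nz fixU]] := fixS i si.
  apply: (socle_sub_fixed sHG modU fixU).
  by apply: rfix_rsim nz; last exact: mx_rsim_sym.
apply: leq_trans dirP; rewrite [leqRHS]big_mkcond /=.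
apply: leq_sum => W _; rewrite -big_filter.
case: ifPn => [|/hasPn no]; last first.
  by rewrite big_seq big_pred0 // => i; rewrite mem_filter andbC;
     apply/negP => /andP[/no/negP].
have uniq_f := filter_uniq (simS^~ W) uniq_s.
move=> _; rewrite big_const_seq iter_addn_0 count_predT.
rewrite -[leqRHS]muln1 leq_mul2l; apply/orP; right.
set f := [seq _ <- _ | _] in uniq_f *.
have eq_f : {in f &, forall i j, i = j}.
  move=> i j; rewrite !mem_filter.
  move=> /andP[/asboolP si i_s] /andP[/asboolP sj j_s]; apply: rS_inj => //.
  exact: mx_rsim_trans (mx_rsim_sym si) sj.
case: f uniq_f eq_f => [|i [|j f]] //= /andP[+ _] /(_ i j).
by rewrite !inE !eqxx orbT negb_or => /andP[/eqP nij _] /(_ isT isT)/nij.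
Qed.

(** * Fixed spaces of tensors under permutations of positions *)

Section Words.

Variables (n : nat) (X : finType).
Local Notation word := {ffun 'I_n -> X}.

Lemma word_permM (w : word) (s t : 'S_n) :
  word_perm w (s * t) = word_perm (word_perm w s) t.
Proof. by apply/ffunP => k; rewrite !ffunE invMg permM. Qed.

Lemma word_perm1 (w : word) : word_perm w 1 = w.
Proof. by apply/ffunP => k; rewrite ffunE invg1 perm1. Qed.

Lemma word_permK (s : 'S_n) :
  cancel (fun w : word => word_perm w s) (fun w => word_perm w s^-1).
Proof. by move=> w; rewrite -word_permM mulgV word_perm1. Qed.

Lemma word_permVK (s : 'S_n) :
  cancel (fun w : word => word_perm w s^-1) (fun w => word_perm w s).
Proof. by move=> w; rewrite -word_permM mulVg word_perm1. Qed.

Definition word_coord (F : fieldType) (v : 'rV[F]_#|{: word}|) (w : word) : F :=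
  v 0 (enum_rank w).

Variable F : fieldType.
Implicit Type v : 'rV[F]_#|{: word}|.

Lemma word_coordP v v' : word_coord v =1 word_coord v' -> v = v'.
Proof.
move=> eq_v; apply/rowP => i; have := eq_v (enum_val i).
by rewrite /word_coord enum_valK.
Qed.

Lemma word_coordZ a v w : word_coord (a *: v) w = a * word_coord v w.
Proof. by rewrite /word_coord mxE. Qed.

Lemma word_coord_sum (I : Type) (r : seq I) (P : pred I)
    (f : I -> 'rV[F]_#|{: word}|) w :
  word_coord (\sum_(i <- r | P i) f i) w
    = \sum_(i <- r | P i) word_coord (f i) w.
Proof. by rewrite /word_coord summxE. Qed.

Lemma word_coord_word_vec w w' : word_coord (word_vec F w) w' = (w == w')%:R.
Proof. by rewrite /word_coord mxE eqxx (inj_eq enum_rank_inj) eq_sym. Qed.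

Lemma word_coord_tensor_mx v (s : 'S_n) w :
  word_coord (v *m tensor_mx F X s) w = word_coord v (word_perm w s^-1).
Proof.
rewrite {1}/word_coord mxE (bigD1 (enum_rank (word_perm w s^-1))) //=.
rewrite big1 => [|i ne_i]; rewrite !mxE.
  by rewrite enum_rankK word_permVK !eqxx mulr1 addr0.
rewrite eqxx (inj_eq enum_rank_inj) /=; case: eqP => [def_w|]; last first.
  by rewrite mulr0.
by case/eqP: ne_i; rewrite def_w word_permK enum_valK.
Qed.

Lemma tensor_mxM (s t : 'S_n) :
  tensor_mx F X (s * t) = tensor_mx F X s *m tensor_mx F X t.
Proof. by case: (tensor_mx_repr F n X) => _ ->; rewrite ?inE. Qed.

(** Marking each position outside A by itself turns two such words into
    rearrangements of one another, and a rearrangement that respects the marks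
    moves positions of A only. *)
Lemma same_content_orbit (A : {set 'I_n}) (w w' : word) :
    (forall i, i \notin A -> w i = w' i) ->
    (forall x, #|[set i in A | w i == x]| = #|[set i in A | w' i == x]|) ->
  exists2 s, s \in Sym A & w' = word_perm w s.
Proof.
move=> eq_out eq_in.
pose mark (w : word) : n.-tuple (X + 'I_n) :=
  [tuple if i \in A then inl (w i) else inr i | i < n].
have /tuple_permP[p def_p] : perm_eq (mark w') (mark w).
  apply/allP => y _ /=; rewrite eq_sym !count_map.
  have card_count (P : pred 'I_n) :
      count P (Finite.enum 'I_n) = #|[set i | P i]|.
    by rewrite cardsE cardE -size_filter.
  rewrite !card_count; case: y => [x|j]; last first.
    by apply/eqP/eq_card => i; rewrite !inE /=; case: ifP.
  apply/eqP; transitivity #|[set i in A | w i == x]|; [|rewrite eq_in].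
    by apply: eq_card => i; rewrite !inE /=; case: ifP.
  by apply: eq_card => i; rewrite !inE /=; case: ifP.
have {}def_p i : (if i \in A then inl (w' i) else inr i)
     = (if p i \in A then inl (w (p i)) else inr (p i)) :> X + 'I_n.
  have := congr1 (fun t => nth (inr i) t i) def_p.
  rewrite -tnth_nth tnth_mktuple => ->.
  rewrite -/(tval (mktuple _)) (nth_map i) ?size_enum_ord // nth_ord_enum.
  by rewrite tnth_mktuple.
have pA i : (p i \in A) = (i \in A) by have := def_p i; do 2 case: ifP.
exists p^-1%g; last first.
  apply/ffunP => i; rewrite ffunE invgK.
  have := def_p i; rewrite pA; case: ifP => iA [] // <-.
  by rewrite eq_out ?iA.
rewrite inE; apply/fintype.subsetP => i; rewrite inE; apply: contraR => iA.
have := def_p i; rewrite pA (negPf iA) => -[def_i].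
by rewrite ?negbK {1}def_i permK.
Qed.

(** A fixed vector has the same coordinate on words in the same orbit, so it
    lies in the span of the indicator vectors of the fibres of an invariant that
    separates orbits: the content on A together with the letters outside A.
    Counting the contents crudely by (|A|+1)^|X| is enough for the asymptotics,
    where |X| is negligible with respect to |A|. *)
Lemma Sym_fixed_rank (A : {set 'I_n}) :
  (\rank (rfix_mx (tensor_repr F n X) (Sym A))
    <= #|A|.+1 ^ #|X| * #|X| ^ (n - #|A|))%N.
Proof.
pose content (w : word) : {ffun X -> 'I_#|A|.+1} :=
  [ffun x => inord #|[set i in A | w i == x]|].
pose outside (w : word) : {ffun {i | i \notin A} -> X} := [ffun i => w (val i)].
pose inv w := (content w, outside w).
have -> : (#|A|.+1 ^ #|X| * #|X| ^ (n - #|A|))%N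
          = #|{: {ffun X -> 'I_#|A|.+1} * {ffun {i | i \notin A} -> X}}|.
  rewrite card_prod !card_ffun card_ord card_sig.
  congr (_ * _ ^ _)%N; rewrite -[n in (n - _)%N]card_ord -(cardC A) addKn.
  by apply: eq_card => i; rewrite !inE.
pose B : 'M[F]_(_, #|{: word}|) :=
  \matrix_(i < #|{: {ffun X -> 'I_#|A|.+1} * {ffun {i | i \notin A} -> X}}|,
           j < #|{: word}|)
    (inv (enum_val j) == enum_val i)%:R.
suff fixB : (rfix_mx (tensor_repr F n X) (Sym A) <= B)%MS.
  exact: leq_trans (mxrankS fixB) (rank_leq_row B).
have inv_orbit w w' :
    inv w = inv w' -> exists2 s, s \in Sym A & w' = word_perm w s.
  move=> [eq_in eq_out]; apply: (same_content_orbit (A := A)) => [i iA|x].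
    have := congr1 (fun f : {ffun _ -> X} => f (Sub i iA)) eq_out.
    by rewrite !ffunE.
  have := congr1 (fun f : {ffun X -> _} => val (f x)) eq_in; rewrite !ffunE /=.
  by rewrite !inordK // ltnS subset_leq_card //; apply/fintype.subsetP => i;
     rewrite inE => /andP[].
apply/row_subP => r; set v := row r _.
have /rfix_mxP fix_v : (v <= rfix_mx (tensor_repr F n X) (Sym A))%MS.
  exact: row_sub.
have v_inv w w' : inv w = inv w' -> word_coord v w = word_coord v w'.
  move=> /inv_orbit[s As ->].
  suff {2}<- : v *m tensor_mx F X s = v.
    by rewrite word_coord_tensor_mx word_permK.
  by apply: fix_v.
apply/submxP; exists (\row_i if [pick w | inv w == enum_val i] is Some w
                            then word_coord v w else 0).
apply/word_coordP => w; rewrite {2}/word_coord mxE.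
rewrite (bigD1 (enum_rank (inv w))) //=.
rewrite big1 => [|i ne_i]; rewrite !mxE !enum_rankK.
  rewrite eqxx mulr1 addr0; case: pickP => [w' /eqP eq_w'|/(_ w)/eqP//].
  exact: v_inv.
case: eqP => [eq_i|]; last by rewrite mulr0.
by case/eqP: ne_i; rewrite eq_i enum_valK.
Qed.

(** Summing over all sets of k positions, rather than fixing one, is what
    makes this subspace stable under 'S_n. *)
Definition some_Sym_fixed (k : nat) : 'M[F]_#|{: word}| :=
  (\sum_(A : {set 'I_n} | #|A| == k) rfix_mx (tensor_repr F n X) (Sym A))%MS.

Lemma some_Sym_fixed_module k :
  mxmodule (tensor_repr F n X) (some_Sym_fixed k).
Proof.
apply/mxmoduleP => s _; rewrite sumsmxMr; apply/sumsmx_subP => A cardA.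
apply: (sumsmx_sup (s @: A)%SET).
  by rewrite card_imset //; exact: perm_inj.
rewrite -rfix_mx_conjsg ?inE ?finset.subsetT //; apply: rfix_mxS.
apply/fintype.subsetP => t; rewrite mem_conjg !inE => on_t.
apply/fintype.subsetP => i; rewrite inE /conjg invgK !permM => ne_i.
rewrite -(mem_imset _ _ (@perm_inj _ s)); apply: (fintype.subsetP on_t).
by rewrite inE; apply: contra ne_i => /eqP ->; rewrite permK.
Qed.

Lemma some_Sym_fixed_rank k :
  (\rank (some_Sym_fixed k) <= 'C(n, k) * (k.+1 ^ #|X| * #|X| ^ (n - k)))%N.
Proof.
apply: leq_trans (mxrank_sum_leqif _) _ => /=.
have := card_draws 'I_n k; rewrite card_ord => <-; rewrite -sum_nat_const.
rewrite [leqRHS](eq_bigl (fun A : {set 'I_n} => #|A| == k)); last first.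
  by move=> A; rewrite inE.
by apply: leq_sum => A /eqP <-; apply: Sym_fixed_rank.
Qed.

End Words.

(** * The cells of a tableau and the dominance order *)

Section Tableau.

Variables (n : nat) (la : partition_of n).

Lemma tab_row_col_inj (k l : 'I_n) :
  tab_row la k = tab_row la l -> tab_col la k = tab_col la l -> k = l.
Proof.
rewrite /tab_col => /(congr1 val) /= eq_row eq_col; apply: val_inj.
by rewrite /= -(reshape_indexK la k) -(reshape_indexK la l) eq_row eq_col.
Qed.

Lemma tab_col_lt (k : 'I_n) : (tab_col la k < nth 0 la (tab_row la k))%N.
Proof. by apply: reshape_offsetP; rewrite sumn_parts. Qed.

Lemma tab_cell (r c : nat) : (c < nth 0 la r)%N ->
  exists k : 'I_n, tab_row la k = r :> nat /\ tab_col la k = c.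
Proof.
move=> lt_c.
have lt_n : (flatten_index la r c < n)%N.
  by rewrite -{2}(sumn_parts la) flatten_indexP.
exists (Ordinal lt_n).
by rewrite /tab_col /= flatten_indexKl ?flatten_indexKr.
Qed.

Lemma card_tab_row (r : nat) :
  #|[set k : 'I_n | val (tab_row la k) == r]| = nth 0%N la r.
Proof.
have /fin_all_exists[f fP] := fun c : 'I_(nth 0%N la r) => tab_cell (ltn_ord c).
have f_inj : injective f.
  move=> c d eq_f; apply: val_inj.
  by rewrite /= -(proj2 (fP c)) eq_f (proj2 (fP d)).
rewrite -[RHS]card_ord -(card_imset _ f_inj); apply: eq_card => k; rewrite inE.
apply/eqP/imsetP => [row_k|[c _ ->]]; last exact: (proj1 (fP c)).
have lt_k : (tab_col la k < nth 0 la r)%N by rewrite -row_k tab_col_lt.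
exists (Ordinal lt_k) => //; have [row_f col_f] := fP (Ordinal lt_k).
apply: tab_row_col_inj => //; apply: val_inj; exact: etrans row_k (esym row_f).
Qed.

Lemma nth_parts_anti (i j : nat) : (i <= j)%N -> (nth 0 la j <= nth 0 la i)%N.
Proof.
move=> le_ij; have [sz_j|lt_j] := leqP (size la) j.
  by rewrite nth_default.
have [la_sorted _ _] := and3P (partsP la).
have geq_trans : transitive geq by move=> x y z /[swap]; apply: leq_trans.
apply: (sorted_leq_nth geq_trans leqnn 0%N la_sorted) => //.
by rewrite inE (leq_ltn_trans le_ij).
Qed.

Lemma first_row_nth : first_row la = nth 0%N la 0.
Proof. by rewrite /first_row; case: (parts la). Qed.

Lemma tab_row_first (k : 'I_n) :
  (k < first_row la)%N -> tab_row la k = 0%N :> nat.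
Proof.
rewrite first_row_nth => /= lt_k.
by have := flatten_indexKl lt_k; rewrite /flatten_index take0 /= add0n.
Qed.

Lemma first_row_le : (first_row la <= n)%N.
Proof.
by rewrite first_row_nth -card_tab_row -[leqRHS]card_ord max_card.
Qed.

(** The inequality behind the dominance order.  An injection is obtained by
    moving each position with letter r < i to the cell of row r in the same
    column, when the column has at least i cells; otherwise all cells of the
    column lie in the first i rows, and the position stays in place. *)
Lemma column_injective_le (w : 'I_n -> nat) (i : nat) :
    (forall k l, tab_col la k = tab_col la l -> w k = w l -> k = l) ->
  (#|[set k | w k < i]| <= #|[set k | tab_row la k < i]|)%N.
Proof.
move=> w_inj.
pose full k := [forall j : 'I_i, tab_col la k < nth 0 la j]%N.
have /fin_all_exists[f fP] k : exists l, tab_col la l = tab_col la k /\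
    ((w k < i)%N -> (tab_row la l < i)%N /\
       if full k then tab_row la l = w k :> nat else l = k).
  have [lt_wi|] := boolP (w k < i)%N; last by exists k.
  (* The column of k meets each of the first i rows, in particular row w k. *)
  have [/forallP/(_ (Ordinal lt_wi))/tab_cell[l [l_row l_col]]|] :=
      boolP (full k).
    by exists l; rewrite l_row.
  rewrite negb_forall => /existsP[j]; rewrite -leqNgt => le_j.
  (* Rows from j on are too short to reach this column. *)
  exists k; split=> // _; split=> //; rewrite ltnNge; apply/negP => le_i.
  have le_j_row := leq_trans (ltnW (ltn_ord j)) le_i.
  have := leq_trans (tab_col_lt k) (nth_parts_anti le_j_row).
  by rewrite ltnNge le_j.
rewrite -(card_in_imset (f := f)); last first.
  move=> k l; rewrite !inE => /(proj2 (fP k))[_ fk] /(proj2 (fP l))[_ fl] eq_f.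
  have eq_col : tab_col la k = tab_col la l.
    by rewrite -(proj1 (fP k)) eq_f (proj1 (fP l)).
  move: fk fl; rewrite /full eq_col eq_f; case: ifP => _ fk fl.
    by apply: w_inj => //; rewrite -fk -fl.
  by rewrite -fk.
apply/subset_leq_card/fintype.subsetP => _ /imsetP[k + ->]; rewrite !inE.
by move=> /(proj2 (fP k))[].
Qed.

End Tableau.

Lemma partition_row_count_inj n (la mu : partition_of n) :
    (forall i,
       #|[set k | tab_row la k < i]| = #|[set k | tab_row mu k < i]|)%N ->
  la = mu.
Proof.
move=> eq_lt.
have card_eq (nu : partition_of n) i : 
    (#|[set k | tab_row nu k < i]| + nth 0 nu i
     = #|[set k | tab_row nu k < i.+1]|)%N.
  rewrite -card_tab_row -cardsUI.
  rewrite [X in (_ + X)%N]eq_card0 ?addn0 => [|k].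
    by apply: eq_card => k; rewrite !inE ltnS [RHS]leq_eqVlt orbC.
  by rewrite !inE; case: ltngtP.
have eq_nth i : nth 0%N la i = nth 0%N mu i.
  apply/eqP; rewrite -(eqn_add2l #|[set k | tab_row la k < i]%N|).
  by rewrite card_eq !eq_lt card_eq.
have size_le (nu ka : partition_of n) :
    (forall i, nth 0 nu i = nth 0 ka i)%N -> (size nu <= size ka)%N.
  move=> eq_nk; rewrite leqNgt; apply/negP => lt_sz.
  have /and3P[_ /negP not0 _] := partsP nu; apply: not0.
  have <- : nth 0%N nu (size ka) = 0%N by rewrite eq_nk nth_default.
  exact: mem_nth.
apply: val_inj; apply: (@eq_from_nth _ 0%N) => [|i _]; last exact: eq_nth.
by apply/eqP; rewrite eqn_leq !size_le // => i; rewrite eq_nth.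
Qed.

(** * Specht modules *)

Section SpechtModules.

Variables (F : fieldType) (n : nat).
Hypothesis charF : [pchar F] =i pred0.
Implicit Types la mu : partition_of n.

Lemma col_stabM la (s t : 'S_n) :
  s \in col_stab la -> (t * s \in col_stab la)%g = (t \in col_stab la).
Proof.
rewrite !inE => /forallP col_s; apply: eq_forallb => k.
by rewrite permM (eqP (col_s _)).
Qed.

(** Homomorphisms preserve this symmetry, so the image of a polytabloid still
    remembers the columns of la. *)
Lemma polytabloid_alt la (s : 'S_n) : s \in col_stab la ->
  polytabloid F la *m tensor_mx F _ s = (-1) ^+ s *: polytabloid F la.
Proof.
move=> col_s; rewrite mulmx_suml scaler_sumr [RHS](reindex_inj (mulIg s)) /=.
apply: eq_big => [t|t _]; first by rewrite col_stabM.
rewrite -scalemxAl word_vec_tensor_mx -word_permM scalerA.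
by rewrite odd_permM signr_addb mulrCA -expr2 sqrr_sign mulr1.
Qed.

Lemma word_coord_polytabloid la w :
  word_coord (polytabloid F la) w
    = \sum_(s in col_stab la) (-1) ^+ s * (word_perm (tabloid la) s == w)%:R.
Proof.
rewrite word_coord_sum; apply: eq_bigr => s _.
by rewrite word_coordZ word_coord_word_vec.
Qed.

(** Only the identity preserves both the rows and the columns of a tableau, so
    no cancellation occurs on the tabloid itself. *)
Lemma word_coord_polytabloid_tabloid la :
  word_coord (polytabloid F la) (tabloid la) = 1.
Proof.
have one_col : (1%g : 'S_n) \in col_stab la.
  by rewrite inE; apply/forallP => k; rewrite perm1.
rewrite word_coord_polytabloid (bigD1 1%g) //= word_perm1 eqxx odd_perm1 mulr1.
rewrite big1 ?addr0 // => s /andP[]; rewrite inE => /forallP col_s ne_s1.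
case: eqP => [eq_tab|]; last by rewrite mulr0.
case/eqP: ne_s1; apply/permP => k; rewrite perm1.
apply: (tab_row_col_inj (la := la)).
  have := congr1 (fun f : {ffun _ -> _} => f (s k)) eq_tab.
  by rewrite !ffunE permK.
exact/eqP.
Qed.

Lemma polytabloid_neq0 la : polytabloid F la != 0.
Proof.
apply: contra_neq (oner_neq0 F) => e0.
by rewrite -(word_coord_polytabloid_tabloid la) e0 /word_coord mxE.
Qed.

Lemma specht_coord mu (y : 'rV[F]_#|{: {ffun 'I_n -> 'I_(size mu)}}|) w :
    (y <= specht_mx F mu)%MS -> word_coord y w != 0 ->
  exists s : 'S_n, w = word_perm (tabloid mu) s.
Proof.
move=> /cyclic_mxP[_ /envelop_mxP[a ->] ->] nz_w.
apply: contrapT => no_s; case/eqP: nz_w.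
rewrite mulmx_sumr word_coord_sum big1 // => s _.
rewrite -scalemxAr word_coordZ word_coord_tensor_mx word_coord_polytabloid.
rewrite big1 ?mulr0 // => t _.
case: eqP => [eq_w|]; last by rewrite mulr0.
by case: no_s; exists (t * s)%g; rewrite word_permM eq_w word_permVK.
Qed.

(** The image y of the polytabloid of shape la has the sign symmetry of the
    columns of la.  A word with equal letters at two positions of a column is
    fixed by their transposition, so its coordinate in y is its own opposite and
    vanishes; hence the words that occur in y, which have content mu, have
    distinct letters in each column of la. *)
Lemma specht_rsim_dominance la mu i :
    mx_rsim (specht_repr F la) (specht_repr F mu) ->
  (#|[set k | tab_row mu k < i]| <= #|[set k | tab_row la k < i]|)%N.
Proof.
move=> [B _ freeB homB].
set U := specht_mx F la; set V := specht_mx F mu.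
have eU : (polytabloid F la <= U)%MS by apply: cyclic_mx_id.
pose y : 'rV_#|{: {ffun 'I_n -> 'I_(size mu)}}| :=
  val_submod (in_submod U (polytabloid F la) *m B).
have yV : (y <= V)%MS by apply: val_submodP.
have y_alt s : s \in col_stab la -> y *m tensor_mx F _ s = (-1) ^+ s *: y.
  move=> col_s; have Gs : s \in [set: 'S_n] by rewrite inE.
  rewrite -(val_submodJ (cyclic_mx_module _ _)) // -mulmxA -homB // mulmxA.
  by rewrite -in_submodJ // polytabloid_alt // linearZ /= -scalemxAl linearZ.
have nz_y : y != 0.
  rewrite val_submod_eq0 -mxrank_eq0 mxrankMfree // mxrank_eq0.
  rewrite -(val_submod_eq0 (U := U)) in_submodK //.
  exact: polytabloid_neq0.
have [w nz_w] : exists w, word_coord y w != 0.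
  apply: contrapT => y0; case/eqP: nz_y; apply/word_coordP => w.
  by rewrite [RHS]mxE; apply: contrapT => nz_w; case: y0; exists w; apply/eqP.
have [s def_w] := specht_coord yV nz_w.
have w_inj k l : tab_col la k = tab_col la l -> w k = w l -> k = l.
  move=> eq_col eq_w; apply/eqP; apply: contraNT nz_w => ne_kl.
  have col_t : tperm k l \in col_stab la.
    rewrite inE; apply/forallP => j.
    by case: tpermP => [->|->|//]; rewrite eq_col.
  have w_t : word_perm w (tperm k l)^-1 = w.
    by apply/ffunP => j; rewrite ffunE invgK; case: tpermP => [->|->|].
  have := word_coord_tensor_mx y (tperm k l) w.
  rewrite y_alt // w_t word_coordZ odd_tperm ne_kl expr1 mulN1r => /eqP.
  rewrite eq_sym -addr_eq0 -mulr2n -mulr_natl mulf_eq0.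
  by rewrite ((pcharf0P F).1 charF) => /orP[].
apply: leq_trans (column_injective_le i (w := val \o w) _); last first.
  by move=> k l eq_col eq_w; apply: w_inj => //; apply: val_inj.
rewrite -(card_imset _ (@perm_inj _ s)); apply/subset_leq_card/fintype.subsetP.
by move=> _ /imsetP[k + ->]; rewrite !inE /= def_w !ffunE permK.
Qed.

Lemma specht_inj la mu :
  mx_rsim (specht_repr F la) (specht_repr F mu) -> la = mu.
Proof.
move=> sim; apply: partition_row_count_inj => i; apply/eqP; rewrite eqn_leq.
by rewrite !specht_rsim_dominance //; apply: mx_rsim_sym.
Qed.

(** The symmetrization z of the polytabloid over Sym A is fixed by Sym A.  It is
    nonzero because Sym A preserves the tabloid, so each of its terms has
    coordinate 1 there, and the characteristic is 0. *)
Lemma specht_fixed la (A : {set 'I_n}) :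
    (forall k, k \in A -> tab_row la k = 0%N :> nat) ->
  rfix_mx (specht_repr F la) (Sym A) != 0.
Proof.
move=> A_row; set U := specht_mx F la.
pose z := \sum_(h in Sym A) polytabloid F la *m tensor_mx F _ h.
have zU : (z <= U)%MS.
  apply: summx_sub => h _.
  have Gh : h \in [set: 'S_n] by rewrite inE.
  rewrite -[tensor_mx F _ h]/(tensor_repr F n 'I_(size la) h).
  exact: (mxmodule_trans (cyclic_mx_module _ _) Gh (cyclic_mx_id _ _)).
have z_fix : (z <= rfix_mx (tensor_repr F n 'I_(size la)) (Sym A))%MS.
  apply/rfix_mxP => h Ah; rewrite mulmx_suml [RHS](reindex_inj (mulIg h)) /=.
  apply: eq_big => [g|g _]; first by rewrite groupMr.
  by rewrite -mulmxA tensor_mxM.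
have nz_z : z != 0.
  suff: word_coord z (tabloid la) != 0.
    by apply: contra_neq => ->; rewrite /word_coord mxE.
  rewrite word_coord_sum (eq_bigr (fun=> 1)) => [|h].
    rewrite sumr_const ((pcharf0P F).1 charF) -lt0n; exact: cardG_gt0.
  rewrite inE => on_h.
  rewrite word_coord_tensor_mx -(word_coord_polytabloid_tabloid la).
  congr word_coord.
  apply/ffunP => k; rewrite !ffunE; apply: val_inj.
  have [Ak|Ak] := boolP (k \in A); last by rewrite invgK (out_perm on_h Ak).
  apply: etrans (A_row _ _) (esym (A_row _ _)) => //.
  by rewrite invgK (perm_closed _ on_h).
apply: contra nz_z => /eqP fix0.
have: in_submod U
    (U :&: rfix_mx (tensor_repr F n 'I_(size la)) (Sym A))%MS == 0.
  rewrite -mxrank_eq0 -(rfix_submod (cyclic_mx_module _ _)) ?finset.subsetT //.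
  by rewrite fix0 mxrank0.
rewrite -(val_submod_eq0 (U := U)) in_submodK ?capmxSl // => /eqP cap0.
by rewrite -submx0 -cap0 sub_capmx zU.
Qed.

End SpechtModules.

(** * The tail of the Schur-Weyl measure *)

Local Open Scope classical_set_scope.
Local Open Scope ring_scope.

(** All the components that are counted lie in the submodule spanned by the
    tensors that are symmetric in some k positions. *)
Lemma sum_schur_weyl_mult_le (F : decFieldType) (N n k : nat)
    (s : seq (partition_of n)) :
    [pchar F] =i pred0 -> uniq s -> {in s, forall mu, (k <= first_row mu)%N} ->
  (\sum_(mu <- s) schur_weyl_mult F N mu * dim_specht F mu
    <= 'C(n, k) * (k.+1 ^ N * N ^ (n - k)))%N.
Proof.
move=> charF uniq_s long_s.
apply: (@leq_trans (\rank (some_Sym_fixed n 'I_N F k))); last first.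
  by have := some_Sym_fixed_rank n 'I_N F k; rewrite card_ord.
apply: sum_repr_mult_le => //; first exact: some_Sym_fixed_module.
  by move=> la mu _ _; apply: specht_inj.
move=> mu mu_s; have le_k := long_s mu mu_s.
have le_kn : (k <= n)%N := leq_trans le_k (first_row_le mu).
pose A : {set 'I_n} := [set widen_ord le_kn i | i : 'I_k]%SET.
have cardA : #|A| = k.
  rewrite card_imset ?card_ord // => i j /(congr1 val) /= eq_ij; exact: val_inj.
exists (Sym A); split; first exact: finset.subsetT.
  apply: specht_fixed => // _ /imsetP[i _ ->].
  by apply: tab_row_first; apply: leq_trans le_k => /=.
by apply: (sumsmx_sup A); rewrite ?cardA.
Qed.

(** The partitions of n are enumerated by their codes, so that countable
    subadditivity reduces the claim to finite sums of the mass function. *)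
Lemma probability_long_row (R : realType) (N n k : nat) (d : measure_display)
    (T : measurableType d) (P : probability T R) (X : T -> partition_of n)
    (Q : partition_of n -> Prop) :
    (0 < N)%N ->
    (forall mu, measurable [set w | X w = mu]) ->
    (forall mu, P [set w | X w = mu] = (schur_weyl R N mu)%:E) ->
    (forall mu, Q mu -> (k <= first_row mu)%N) ->
  (P [set w | Q (X w)] <= (('C(n, k) * k.+1 ^ N)%:R / N%:R ^+ k)%:E)%E.
Proof.
move=> N_gt0 measX lawX Q_long.
pose E i := [set w | Q (X w) /\ pickle (X w) = i].
pose law i : R := if pickle_inv i is Some mu then
                    if `[< Q mu >] then schur_weyl R N mu else 0 else 0.
have E_event i : measurable (E i) /\ P (E i) = (law i)%:E.
  rewrite /law; case def_i: (pickle_inv i) => [mu|]; last first.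
    rewrite (_ : E i = set0) ?measure0 //.
    by apply/seteqP; split=> w //= [_ eq_i]; rewrite -eq_i pickleK_inv in def_i.
  have := @pickle_invK (partition_of n) i; rewrite def_i /= => pick_mu.
  case: asboolP => Qmu.
    rewrite (_ : E i = [set w | X w = mu]) //.
    apply/seteqP; split=> w; rewrite /E /=; last by move=> ->.
    move=> [_ eq_i].
    by apply: (pcan_inj pickleK); rewrite pick_mu.
  rewrite (_ : E i = set0) ?measure0 //.
  apply/seteqP; split=> w //= [Qw eq_i]; apply: Qmu.
  by rewrite (_ : mu = X w) //; apply: (pcan_inj pickleK); rewrite pick_mu.
have cover : [set w | Q (X w)] = \bigcup_i E i.
  by apply/seteqP; split=> [w Qw|w [i _ []] //]; exists (pickle (X w)).
have measE i : measurable (E i) by case: (E_event i).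
have measQ : measurable [set w | Q (X w)].
  by rewrite cover; apply: bigcup_measurable.
apply: le_trans (measure_sigma_subadditive P measE measQ _) _.
  by rewrite cover.
apply: lime_le.
  by apply: is_cvg_nneseries => i _ _; apply: measure_ge0.
near=> m.
rewrite (eq_bigr (fun i => (law i)%:E)) => [|i _]; last by case: (E_event i).
rewrite sumEFin lee_fin.
pose s := [seq mu <- pmap (@pickle_inv (partition_of n)) (index_iota 0 m)
          | `[< Q mu >]].
have -> : \sum_(0 <= i < m) law i = \sum_(mu <- s) schur_weyl R N mu.
  rewrite big_filter [RHS]big_mkcond big_pmap.
  by apply: eq_bigr => i _; rewrite /law; case: pickle_inv.
have uniq_s : uniq s.
  by rewrite filter_uniq // (pmap_uniq pickle_invK) // iota_uniq.
have long_s : {in s, forall mu, (k <= first_row mu)%N}.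
  by move=> mu; rewrite mem_filter => /andP[/asboolP/Q_long].
have := sum_schur_weyl_mult_le N (pchar_num R[i]) uniq_s long_s.
rewrite -(ler_nat R) natr_sum => le_sum.
rewrite /schur_weyl -mulr_suml ler_pdivrMr ?exprn_gt0 ?ltr0n //.
apply: le_trans le_sum _.
(* N ^ (n - k) is N ^ n / N ^ k only for k <= n. *)
have [lt_nk|le_kn] := ltnP n k; first by rewrite bin_small // !mul0n !mul0r.
rewrite mulnA natrM -mulrA ler_wpM2l // natrX.
rewrite -{2}(subnK le_kn) exprD mulrCA mulVf ?mulr1 //.
by rewrite expf_neq0 // pnatr_eq0 -lt0n.
Unshelve. all: by end_near. Qed.

(** * Asymptotics of the tail bound *)

(** k^k <= (k+1) ... (2k) = C(2k,k) k! and C(2k,k) <= 2^(2k). *)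
Lemma expn_le_fact (k : nat) : (k ^ k <= 4 ^ k * k`!)%N.
Proof.
apply: (@leq_trans ('C(k + k, k) * k`!)%N).
  rewrite bin_ffact ffact_prod //.
  have {1}-> : (k ^ k = \prod_(i < k) k)%N by rewrite prod_nat_const card_ord.
  by apply: leq_prod => i _; rewrite -addnBA ?leq_addr // ltnW.
rewrite leq_mul2r; apply/orP; right.
rewrite -[4%N]/(2 ^ 2)%N -expnM mul2n -addnn -[2%N]/(1 + 1)%N expnDn.
have lt_k : (k < (k + k).+1)%N by rewrite ltnS leq_addr.
rewrite (bigD1 (Ordinal lt_k)) //= !exp1n !muln1; exact: leq_addr.
Qed.

Lemma bin_expn_le (n k : nat) : ('C(n, k) * k ^ k <= (4 * n) ^ k)%N.
Proof.
apply: (@leq_trans (4 ^ k * ('C(n, k) * k`!))%N).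
  by rewrite mulnCA leq_mul2l expn_le_fact orbT.
rewrite bin_ffact expnMn leq_mul2l ffact_prod; apply/orP; right.
have -> : (n ^ k = \prod_(i < k) n)%N by rewrite prod_nat_const card_ord.
by apply: leq_prod => i _; apply: leq_subr.
Qed.

Section Asymptotics.

Variable R : realType.

Lemma powR_ge_near (a A : R) : 0 < a -> \forall n \near \oo, A <= n%:R `^ a.
Proof.
move=> a_gt0; near=> n.
have [A_le0|A_gt0] := leP A 0; first exact: le_trans (powR_ge0 _ _).
have A_root : A = (A `^ a^-1) `^ a.
  by rewrite -powRrM mulVf ?gt_eqF // powRr1 // ltW.
rewrite A_root ge0_ler_powR ?nnegrE ?powR_ge0 //; first exact: ltW.
near: n; exact: nbhs_infty_ger.
Unshelve. all: by end_near. Qed.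

Lemma natr_pow_expR_le (y : R) (m k : nat) :
  0 < y -> m%:R * ln y <= k%:R -> y ^+ m <= expR 1 ^+ k.
Proof.
by move=> y0 le_k; rewrite -[in leLHS](lnK y0) -!expRM_natl mulr1 ler_expR.
Qed.

(** For k > n the left-hand side is 0; otherwise k + 1 <= 2n, which turns the
    condition on N into (k+1)^N <= e^k. *)
Lemma long_row_bound_le (n k N : nat) :
  (0 < k)%N -> (0 < N)%N -> N%:R * ln (2 * n%:R) <= k%:R :> R ->
  ('C(n, k) * k.+1 ^ N)%:R / N%:R ^+ k
    <= (4 * expR 1 * n%:R / (k%:R * N%:R)) ^+ k :> R.
Proof.
move=> k_gt0 N_gt0 le_k.
have [lt_nk|le_kn] := ltnP n k.
  by rewrite bin_small // mul0n mul0r exprn_ge0 // divr_ge0 //.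
have n_gt0 := leq_trans k_gt0 le_kn.
have kR : 0 < k%:R :> R by rewrite ltr0n.
have NR : 0 < N%:R :> R by rewrite ltr0n.
have le_exp : (k.+1%:R : R) ^+ N <= expR 1 ^+ k.
  apply: (@le_trans _ _ ((2 * n%:R) ^+ N)); last first.
    by apply: natr_pow_expR_le => //; rewrite mulr_gt0 // ltr0n.
  by rewrite lerXn2r ?nnegrE // -natrM ler_nat; lia.
have le_bin : 'C(n, k)%:R * k%:R ^+ k <= (4 * n%:R) ^+ k :> R.
  by rewrite -natrX -!natrM -natrX ler_nat bin_expn_le.
rewrite natrM natrX ler_pdivrMr ?exprn_gt0 // -exprMn.
have -> : 4 * expR 1 * n%:R / (k%:R * N%:R) * N%:R
          = 4 * n%:R * expR 1 / k%:R :> R.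
  by field; rewrite !gt_eqF.
rewrite expr_div_n ler_pdivlMr ?exprn_gt0 // mulrAC exprMn.
exact: ler_pM.
Qed.

Lemma ln_double_le_powR (g : R) (x : R) : 0 < g -> 1 <= x ->
  ln (2 * x) <= (1 + g^-1) * x `^ g.
Proof.
move=> g_gt0 x_ge1; have x_gt0 : 0 < x by lra.
have xg1 : 1 <= x `^ g by rewrite -(powRr0 x) ler_powR // ltW.
rewrite lnM ?posrE // mulrDl mul1r lerD //.
  by apply: le_trans xg1; rewrite -[2]/(1 + 1); apply: le_ln1Dx; lra.
rewrite ler_pdivlMl // -ln_powR; apply/ltW/ln_sublinear; lra.
Qed.

Lemma equiv_powR_bounds (c alpha : R) (N : nat -> nat) : 0 < c ->
    (fun n : nat => (N n)%:R : R^o)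
      ~_\oo (fun n : nat => c * n%:R `^ alpha : R^o) ->
  \forall n \near \oo,
    c / 2 * n%:R `^ alpha <= (N n)%:R <= 2 * c * n%:R `^ alpha.
Proof.
move=> c_gt0 /eqaddoP/(_ (1 / 2)); rewrite divr_gt0 // => /(_ isT).
apply: filterS => n /=; rewrite !fctE /=.
have := powR_ge0 n%:R alpha; set p := n%:R `^ alpha => p_ge0.
have cp_ge0 : 0 <= c * p by rewrite mulr_ge0 // ltW.
rewrite normrM (ger0_norm p_ge0) (gtr0_norm c_gt0) ler_distl => /andP[lo hi].
by apply/andP; split; lra.
Qed.

(** With g = (1 - 2 alpha + eps) / 2 > 0 one has
    n^(1 - alpha + eps) = n^alpha n^g n^g: the first factor absorbs N, the
    second one the logarithm, and the third one the constants. *)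
Lemma growth_conditions (c alpha eps delta : R) (N : nat -> nat) :
    0 < c -> alpha < 1 / 2 -> 0 < eps -> 0 < delta ->
    (fun n : nat => (N n)%:R : R^o)
      ~_\oo (fun n : nat => c * n%:R `^ alpha : R^o) ->
  \forall n \near \oo, forall k : nat,
    delta * n%:R `^ (1 - alpha + eps) < k%:R ->
    (N n)%:R * ln (2 * n%:R) <= k%:R :> R /\
    4 * expR 1 * n%:R / (k%:R * (N n)%:R)
      <= 8 * expR 1 / (delta * c) * n%:R `^ (- eps).
Proof.
move=> c_gt0 alpha_lt eps_gt0 delta_gt0 hN.
pose g := (1 - 2 * alpha + eps) / 2.
have g_gt0 : 0 < g by rewrite /g; lra.
near=> n => k lt_k.
have n_gt0 : (0 < n)%N by near: n; exact: nbhs_infty_gt.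
have n_ge1 : 1 <= n%:R :> R by rewrite ler1n.
have nR : 0 < n%:R :> R by rewrite ltr0n.
have /andP[lo hi] : c / 2 * n%:R `^ alpha <= (N n)%:R <= 2 * c * n%:R `^ alpha.
  by near: n; exact: equiv_powR_bounds.
have p_gt0 a : 0 < n%:R `^ a :> R by rewrite powR_gt0.
have pD a b : n%:R `^ (a + b) = n%:R `^ a * n%:R `^ b :> R.
  by rewrite powRD // (gt_eqF nR) implybT.
split.
  apply: le_trans (ltW lt_k).
  have -> : 1 - alpha + eps = alpha + g + g by rewrite /g; field.
  rewrite !pD.
  have n_large : 2 * c * (1 + g^-1) / delta <= n%:R `^ g.
    by near: n; exact: powR_ge_near.
  apply: (@le_trans _ _ (2 * c * n%:R `^ alpha * ((1 + g^-1) * n%:R `^ g))).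
    apply: ler_pM => //; last exact: ln_double_le_powR.
    by apply: ln_ge0; lra.
  move: n_large; rewrite ler_pdivrMr // => n_large.
  rewrite [leLHS](_ : _ = n%:R `^ alpha * n%:R `^ g * (2 * c * (1 + g^-1)));
    last by ring.
  rewrite [leRHS](_ : _ = n%:R `^ alpha * n%:R `^ g * (n%:R `^ g * delta));
    last by ring.
  by rewrite ler_wpM2l // mulr_ge0 // ltW.
have k_gt0 : 0 < k%:R :> R by apply: le_lt_trans lt_k; rewrite mulr_ge0 // ltW.
have N_gt0 : 0 < (N n)%:R :> R.
  by apply: lt_le_trans lo; rewrite mulr_gt0 // divr_gt0.
rewrite ler_pdivrMr ?mulr_gt0 //.
have -> : 4 * expR 1 * n%:R = 8 * expR 1 / (delta * c) * n%:R `^ (- eps) *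
   (delta * n%:R `^ (1 - alpha + eps) * (c / 2 * n%:R `^ alpha)) :> R.
  rewrite !pD powRr1 ?ltW // !powRN; field.
  by rewrite !gt_eqF.
rewrite ler_wpM2l //.
  by rewrite mulr_ge0 // ltW // divr_gt0 ?mulr_gt0 // expR_gt0.
by apply: ler_pM => //; rewrite ?mulr_ge0 // ltW // divr_gt0.
Unshelve. all: by end_near. Qed.

End Asymptotics.

(** * Lengths of first rows *)

Theorem proposition4 (R : realType) (c alpha : R) (N : nat -> nat)
    (hc : 0 < c) (halpha : alpha < 1 / 2)
    (hN : forall n : nat, (0 < n)%N -> (0 < N n)%N)
    (hNasymp : (fun n : nat => (N n)%:R : R^o)
                 ~_\oo (fun n : nat => c * n%:R `^ alpha : R^o))
    (d : nat -> measure_display)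
    (Omega : forall n : nat, measurableType (d n))
    (P : forall n : nat, probability (Omega n) R)
    (la : forall n : nat, Omega n -> partition_of n)
    (hmeas : forall (n : nat) (mu : partition_of n), (0 < n)%N ->
       measurable [set w : Omega n | la n w = mu])
    (hlaw : forall (n : nat) (mu : partition_of n), (0 < n)%N ->
       P n [set w : Omega n | la n w = mu] = (schur_weyl R (N n) mu)%:E) :
  forall eps : R, 0 < eps ->
  forall delta : R, 0 < delta ->
    P n [set w : Omega n |
           delta < `|(first_row (la n w))%:R / n%:R `^ (1 - alpha + eps)|]
      @[n --> \oo] --> 0%E.
Proof.
move=> eps eps_gt0 delta delta_gt0.
(* growth_conditions bounds the base of the exponential tail by C n^(-eps). *)
pose C := 8 * expR 1 / (delta * c).
have C_gt0 : 0 < C by rewrite divr_gt0 ?mulr_gt0 // expR_gt0.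
have bound_cvg : (C * n%:R `^ (- eps))%:E @[n --> \oo] --> 0%E.
  apply: cvg_EFin; first by near=> n.
  apply/cvgr0Pnorm_le => e e_gt0; near=> n.
  have n_gt0 : 0 < n%:R :> R by rewrite ltr0n; near: n; exact: nbhs_infty_gt.
  have le_n : C / e <= n%:R `^ eps by near: n; exact: powR_ge_near.
  have bound_ge0 : 0 <= C * n%:R `^ (- eps).
    by apply: mulr_ge0; [exact: ltW|exact: powR_ge0].
  rewrite /= (ger0_norm bound_ge0) powRN.
  by rewrite ler_pdivrMr ?powR_gt0 // mulrC -ler_pdivrMr.
apply: squeeze_cvge (cvg_cst 0%E) bound_cvg.
near=> n; rewrite measure_ge0 /=.
have n_gt0 : (0 < n)%N by near: n; exact: nbhs_infty_gt.
have p_gt0 : 0 < n%:R `^ (1 - alpha + eps) by rewrite powR_gt0 ?ltr0n.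
pose k := (Num.truncn (delta * n%:R `^ (1 - alpha + eps))).+1.
have lt_k : delta * n%:R `^ (1 - alpha + eps) < k%:R by exact: truncnS_gt.
have growth : forall k : nat, delta * n%:R `^ (1 - alpha + eps) < k%:R ->
    (N n)%:R * ln (2 * n%:R) <= k%:R :> R /\
    4 * expR 1 * n%:R / (k%:R * (N n)%:R) <= C * n%:R `^ (- eps).
  by near: n; exact: growth_conditions.
have [le_ln le_base] := growth k lt_k.
have base_le1 : C * n%:R `^ (- eps) <= 1.
  rewrite powRN ler_pdivrMr ?powR_gt0 ?ltr0n // mul1r.
  by near: n; exact: powR_ge_near.
pose Q (mu : partition_of n) : Prop :=
  delta < `|(first_row mu)%:R / n%:R `^ (1 - alpha + eps)|.
have Q_long mu : Q mu -> (k <= first_row mu)%N.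
  rewrite /Q ger0_norm ?divr_ge0 ?(ltW p_gt0) // ltr_pdivlMr // => lt_row.
  by rewrite truncn_lt_nat // mulr_ge0 // ltW.
apply: le_trans (probability_long_row (hN n n_gt0) _ _ Q_long) _.
- by move=> mu; apply: hmeas.
- by move=> mu; apply: hlaw.
have bound_ge0 : 0 <= C * n%:R `^ (- eps).
  by apply: mulr_ge0; [exact: ltW|exact: powR_ge0].
have e_ge0 : 0 <= expR 1 :> R by exact: expR_ge0.
rewrite lee_fin.
apply: le_trans (long_row_bound_le _ (hN n n_gt0) le_ln) _ => //.
apply: (@le_trans _ _ ((C * n%:R `^ (- eps)) ^+ k)).
  by apply: lerXn2r le_base; rewrite nnegrE // divr_ge0 ?mulr_ge0.
by rewrite exprS ler_piMr // exprn_ile1.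
Unshelve. all: by end_near. Qed.
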